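(* Let $n \ge 2$. For every tree $t$ on $n$ vertices, $$D_{max}^t \le D_{max}^{b\text{-}bistar} = \frac{1}{4}\left(3(n-1)^2 + 1 - (n \bmod 2)\right),$$ where $D_{max}^{b\text{-}bistar}$ denotes $D_{max}$ of the balanced bistar tree on $n$ vertices.
   Context: A linear arrangement of a graph $g$ on $n$ vertices is a bijection $\pi$ from its vertex set to $\{1,\dots,n\}$. The sum of edge lengths is $D^g(\pi)=\sum_{\{u,v\}\in E(g)}|\pi(u)-\pi(v)|$. $D_{max}^g$ (resp. $D_{min}^g$) is the maximum (resp. minimum) of $D^g(\pi)$ over all $n!$ linear arrangements. A bistar tree on $n\ge 2$ vertices is a tree obtained by taking two star trees (a star on $s$ vertices is a tree with one vertex adjacent to all other $s-1$ vertices; a star on 1 vertex is a single vertex) with $s_1$ and $s_2$ vertices, $s_1+s_2=n$, and adding an edge between their hubs; its maximum degree is $k_1=\max(s_1,s_2)$ and the other hub has degree $n-k_1$. The balanced bistar tree on $n$ vertices is the bistar tree with $k_1=\lceil n/2\rceil$. *)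

(* Defs.v *)
From HB Require Import structures.
From mathcomp Require Import all_boot all_order all_algebra.

Set Implicit Arguments.
Unset Strict Implicit.
Unset Printing Implicit Defensive.

Record sgraph := SGraph {
  svertex : finType;
  sedge : rel svertex;
  sedge_sym : symmetric sedge;
  sedge_irr : irreflexive sedge
}.

Coercion svertex : sgraph >-> finType.

Definition connected (g : sgraph) : Prop :=
  0 < #|g| /\ forall x y : g, connect (@sedge g) x y.

(* Every edge x -- y yields the degenerate ucycle [:: x; y]; the graph-theoretic
   cycles are the ucycles with at least three vertices. *)
Definition acyclic (g : sgraph) : Prop :=
  forall c : seq g, ucycle (@sedge g) c -> size c <= 2.

Definition is_tree (g : sgraph) : Prop := connected g /\ acyclic g.

Definition is_arrangement (g : sgraph) (pi : {ffun g -> 'I_#|g|}) : bool :=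
  injectiveb pi && [forall i, i \in codom pi].

(* The position of u in {1, ..., n}, as 'I_n is {0, ..., n - 1}. *)
Definition pos (g : sgraph) (pi : {ffun g -> 'I_#|g|}) (u : g) : nat :=
  (pi u).+1.

(* Each undirected edge {u, v} is represented once, by the ordered pair whose
   first component comes first in the enumeration of the vertices. *)
Definition edges (g : sgraph) : {set g * g} :=
  [set p : g * g | sedge p.1 p.2 && (enum_rank p.1 < enum_rank p.2)].

Definition D (g : sgraph) (pi : {ffun g -> 'I_#|g|}) : nat :=
  \sum_(p in edges g) `|pos pi p.1 - pos pi p.2|%N.

Definition Dmax (g : sgraph) : nat :=
  \max_(pi : {ffun g -> 'I_#|g|} | is_arrangement pi) D pi.

(* Star on s >= 1 vertices, with hub 0. *)
Definition star_rel (s : nat) : rel 'I_s :=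
  [rel i j : 'I_s | (i != j) && ((i == 0 :> nat) || (j == 0 :> nat))].

(* Two stars with s1, s2 >= 1 vertices, their hubs joined by an edge. *)
Definition bistar_rel (s1 s2 : nat) : rel ('I_s1 + 'I_s2)%type :=
  fun x y => match x, y with
  | inl i, inl j => star_rel i j
  | inr i, inr j => star_rel i j
  | inl i, inr j | inr j, inl i => (i == 0 :> nat) && (j == 0 :> nat)
  end.

Lemma star_rel_sym s : symmetric (@star_rel s).
Proof. by move=> i j; rewrite /star_rel /= eq_sym orbC. Qed.

Lemma bistar_rel_sym s1 s2 : symmetric (@bistar_rel s1 s2).
Proof. by move=> [i|i] [j|j] //=; rewrite star_rel_sym. Qed.

Lemma bistar_rel_irr s1 s2 : irreflexive (@bistar_rel s1 s2).
Proof. by move=> [i|i]; rewrite /= /star_rel /= eqxx. Qed.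

Definition bistar (s1 s2 : nat) : sgraph :=
  SGraph (@bistar_rel_sym s1 s2) (@bistar_rel_irr s1 s2).

(* s1 = ceil(n/2) and s2 = floor(n/2), so that max(s1, s2) = ceil(n/2); both
   are positive when n >= 2. *)
Definition balanced_bistar (n : nat) : sgraph := bistar (uphalf n) n./2.

(* Main.v *)
Require Import Defs.
From HB Require Import structures.
From mathcomp Require Import all_boot all_order all_algebra.
From mathcomp Require Import zify ring.

Set Implicit Arguments.
Unset Strict Implicit.
Unset Printing Implicit Defensive.

(** In an arrangement of [n] vertices let [w p = min (p, n - 1 - p)] be the
    distance of the position [p] to the nearer end.  An edge between positions
    [p] and [q] has length at most [n/2 + #{k < (n-1)/2 | w p, w q <= k}].
    At most [2(k+1)] vertices have [w <= k], so a tree has at most [2k+1] edges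
    among them.  Summing over the edges gives
    [D <= (n-1) (n/2) + \sum_(k < (n-1)/2) (2k+1)].  The balanced bistar attains
    this bound when each hub sits at one end and its leaves on the opposite
    half. *)

(** * Edge counts in acyclic graphs *)

Definition degree_in (g : sgraph) (S : {set g}) (x : g) : nat :=
  \sum_(y in S) sedge x y.

Lemma degree_in_ge2 (g : sgraph) (S : {set g}) (x z : g) :
  1 < degree_in S x -> exists y, [/\ y \in S, sedge x y & y != z].
Proof.
move=> deg2; case: (pickP [pred y | [&& y \in S, sedge x y & y != z]]).
  by move=> y /and3P[]; exists y.
move=> noy; move: deg2; rewrite ltnNge; case/negP.
apply: (@leq_trans (\sum_(y in S) (y == z))).
  apply: leq_sum => y yS; have := noy y; rewrite /= yS /=.
  by case: (sedge x y); case: (y == z).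
rewrite -big_mkcondr sum1_card /= -[leqRHS](cards1 z).
by apply/subset_leq_card/subsetP => y; rewrite inE => /andP[_].
Qed.

(** The path grows at its head [x]: one of the two neighbours of [x] in [S] differs from the next
    vertex, and it cannot already lie on the path, as that would close a cycle. *)
Lemma acyclic_long_path (g : sgraph) (S : {set g}) : acyclic g ->
  (forall x, x \in S -> 1 < degree_in S x) -> forall x0, x0 \in S ->
  forall k, exists x p, [/\ x \in S, path (@sedge g) x p, uniq (x :: p)
                          & size p = k].
Proof.
move=> acy deg2 x0 x0S; elim=> [|k [x [p [xS xp Up <-]]]].
  by exists x0, [::].
have [y [yS exy yNh]] := degree_in_ge2 (head x p) (deg2 x xS).
exists y, (x :: p); rewrite /= sedge_sym exy xp; split=> //.
rewrite -/(uniq (x :: p)) Up andbT inE negb_or; apply/andP; split.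
  by apply: contraTneq exy => ->; rewrite sedge_irr.
apply/negP => yp; case/splitPr: yp xp Up yNh => p1 p2.
rewrite cat_path /= => /and3P[xp1 ep1y _] /=.
rewrite mem_cat cat_uniq /= inE !negb_or.
case/and3P=> /and3P[xp1' xy _] Up1 /andP[/andP[yp1 _] _] yNh.
(* The segment from [x] to [y] closes up through the edge [x] -- [y]. Acyclicity then forces [p1] to
   be empty, so [y] would be the head of the path, contrary to [yNh]. *)
have := acy (x :: rcons p1 y); rewrite /ucycle /= !rcons_path last_rcons xp1.
rewrite ep1y sedge_sym exy mem_rcons inE negb_or xy xp1' rcons_uniq yp1 Up1.
move/(_ isT); rewrite size_rcons; case: p1 yNh {xp1 ep1y xp1' Up1 yp1} => //=.
by rewrite eqxx.
Qed.

(** Otherwise there would be a path on [#|g| + 1] distinct vertices. *)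
Lemma acyclic_leaf (g : sgraph) (S : {set g}) : acyclic g -> S != set0 ->
  exists2 x, x \in S & degree_in S x <= 1.
Proof.
move=> acy /set0Pn[x0 x0S].
case: (pickP [pred x | (x \in S) && (degree_in S x <= 1)]).
  by move=> x /andP[]; exists x.
move=> nox; have deg2 x : x \in S -> 1 < degree_in S x.
  by move=> xS; have := nox x; rewrite /= xS /= ltnNge => ->.
have [x [p [_ _ /card_uniqP Up sz]]] := acyclic_long_path acy deg2 x0S #|g|.
by have := max_card (mem (x :: p)); rewrite Up /= sz ltnn.
Qed.

(** The forest bound on induced edges, each edge counted at both ends. Deleting a vertex of degree
    at most 1 lowers the sum by at most 2. *)
Lemma acyclic_degree_sum (g : sgraph) (S : {set g}) : acyclic g ->
  \sum_(x in S) degree_in S x <= #|S|.-1.*2.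
Proof.
move=> acy; have [n] := ubnP #|S|; elim: n S => // n IHn S; rewrite ltnS => leSn.
have [->|S0] := eqVneq S set0; first by rewrite big_set0.
have [x xS dx] := acyclic_leaf acy S0.
have dE y : degree_in S y = sedge y x + degree_in (S :\ x) y.
  by rewrite /degree_in (big_setD1 x).
have dxE : degree_in (S :\ x) x = degree_in S x by rewrite dE sedge_irr.
rewrite (big_setD1 x) //= (eq_bigr _ (fun y _ => dE y)) big_split /=.
under eq_bigr do rewrite sedge_sym.
rewrite -/(degree_in (S :\ x) x) dxE.
have cS := cardsD1 x S; rewrite xS in cS.
have := IHn (S :\ x); rewrite {1}(_ : #|S :\ x| < n = true) => [/(_ isT)|]; last by lia.
(* For a single vertex the predecessor truncates and the right-hand side does not drop, but then the
   degree of [x] is 0. *)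
have [S'0|] := eqVneq (S :\ x) set0; last by rewrite -card_gt0 => *; lia.
by rewrite -dxE S'0 /degree_in !big_set0.
Qed.

(** * Edge lengths and the upper bound *)

Lemma double_D (g : sgraph) (pi : {ffun g -> 'I_#|g|}) :
  (D pi).*2 = \sum_x \sum_y sedge x y * `|pi x - pi y|%N.
Proof.
pose F (p : g * g) := sedge p.1 p.2 * `|pi p.1 - pi p.2|%N.
rewrite (pair_bigA _ (fun x y => F (x, y))) /=.
under [RHS]eq_bigr do rewrite -surjective_pairing.
have DE : D pi = \sum_(p : g * g | enum_rank p.1 < enum_rank p.2) F p.
  rewrite /D [RHS]big_mkcond [LHS]big_mkcond; apply: eq_bigr => -[x y] _.
  rewrite inE /F /=; case: (sedge x y) => /=; case: ifP => _ //=.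
  by rewrite mul1n /pos -[(pi x).+1]add1n -[(pi y).+1]add1n distnDl.
rewrite (bigID (fun p : g * g => enum_rank p.1 < enum_rank p.2)) /= -DE -addnn.
(* Swapping the components exchanges the two orders of an edge; the diagonal contributes nothing by
   irreflexivity. *)
congr addn; rewrite DE (reindex_inj (h := fun p : g * g => (p.2, p.1))) /=; last first.
  by move=> [x y] [x' y'] [-> ->].
rewrite [LHS]big_mkcond [RHS]big_mkcond; apply: eq_bigr => -[x y] _.
rewrite /F /= -leqNgt sedge_sym distnC; case: ltngtP => // /val_inj/enum_rank_inj->.
by rewrite sedge_irr.
Qed.

Definition end_dist (n p : nat) : nat := minn p (n.-1 - p).

(** A position of end distance [w] is at most [n - 1 - w] away from any other. Here
    [n - 1 = n./2 + n.-1./2], and the sum counts the [k] from the larger end distance on. *)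
Lemma dist_le_end_dist (n p q : nat) : p < n -> q < n ->
  `|p - q|%N <= n./2 + \sum_(k < n.-1./2) (end_dist n p <= k) * (end_dist n q <= k).
Proof.
move=> pn qn.
have -> : \sum_(k < n.-1./2) (end_dist n p <= k) * (end_dist n q <= k)
    = n.-1./2 - maxn (end_dist n p) (end_dist n q).
  under eq_bigr do rewrite mulnb -geq_max.
  elim: (n.-1./2) => [|m IHm]; first by rewrite big_ord0.
  by rewrite big_ord_recr /= IHm; lia.
rewrite /end_dist; lia.
Qed.

Lemma card_end_dist_le (n k : nat) (T : finType) (f : T -> 'I_n) :
  injective f -> #|[set x | end_dist n (f x) <= k]| <= k.+1.*2.
Proof.
move=> f_inj; set S := [set x | _].
(* Positions near the left end keep their index; those near the right end are numbered inwards from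
   [k.+1]. The extra value [ord_max] makes the type fit [inord] and is never attained. *)
pose h x : 'I_(k.+1.*2).+1 :=
  inord (if f x <= k then f x : nat else k.+1 + (n.-1 - f x)).
have hE x : x \in S ->
    h x = (if f x <= k then f x : nat else k.+1 + (n.-1 - f x)) :> nat.
  by rewrite inE /end_dist => xS; rewrite inordK //; case: ifP => ?; lia.
have h_inj : {in S &, injective h}.
  move=> x y xS yS /(congr1 val) /=; rewrite !hE // => hxy.
  apply/f_inj/val_inj => /=; have := ltn_ord (f x); have := ltn_ord (f y).
  by move: hxy; case: ifP; case: ifP; lia.
rewrite -(card_in_imset h_inj) -ltnS -[ltnRHS]card_ord -cardsT.
apply/proper_card/properP; split; first exact: subsetT.
exists ord_max => //; apply/imsetP => -[x xS /(congr1 val)] /=; rewrite hE //.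
by move: xS; rewrite inE /end_dist; have := ltn_ord (f x); case: ifP; lia.
Qed.

Definition max_length_sum (n : nat) : nat := n.-1 * n./2 + n.-1./2 ^ 2.

Lemma sum_odd (m : nat) : \sum_(k < m) k.*2.+1 = m ^ 2.
Proof.
elim: m => [|m IHm]; first by rewrite big_ord0.
by rewrite big_ord_recr /= IHm -!mulnn; nia.
Qed.

Lemma acyclic_D_le (g : sgraph) (pi : {ffun g -> 'I_#|g|}) :
  acyclic g -> injective pi -> D pi <= max_length_sum #|g|.
Proof.
move=> acy pi_inj; set n := #|g|; rewrite -leq_double double_D.
pose S k := [set x | end_dist n (pi x) <= k].
have degE (A : {set g}) : \sum_(x in A) degree_in A x
    = \sum_x \sum_y sedge x y * ((x \in A) * (y \in A)).
  rewrite big_mkcond; apply: eq_bigr => x _; rewrite /degree_in.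
  case: (x \in A); last by rewrite big1 // => y _; rewrite muln0.
  by rewrite big_mkcond; apply: eq_bigr => y _; case: (y \in A); rewrite ?muln1 ?muln0.
apply: (@leq_trans (\sum_x \sum_y (sedge x y * n./2 +
   \sum_(k < n.-1./2) sedge x y * ((x \in S k) * (y \in S k))))).
  apply: leq_sum => x _; apply: leq_sum => y _.
  rewrite -big_distrr -mulnDr leq_mul2l; apply/orP; right.
  under eq_bigr do rewrite !inE.
  exact: dist_le_end_dist.
under eq_bigr do rewrite big_split exchange_big /=.
rewrite big_split /= /max_length_sum doubleD leq_add //.
  (* The constant [n./2] is paid once per edge, hence at most [n - 1] times. *)
  have := acyclic_degree_sum [set: g] acy; rewrite degE cardsT -/n => le_arcs.
  rewrite doubleMl; apply: leq_trans (leq_mul le_arcs (leqnn n./2)).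
  rewrite big_distrl leq_sum // => x _; rewrite big_distrl leq_sum // => y _.
  by rewrite !inE !muln1.
(* With [k] outermost, the inner double sum is twice the number of edges inside [S k]. *)
rewrite exchange_big -sum_odd -muln2 big_distrl; apply: leq_sum => k _.
rewrite -degE; apply: leq_trans (acyclic_degree_sum _ acy) _.
rewrite /= muln2 leq_double -ltnS; have := card_end_dist_le k pi_inj.
by rewrite -/n -/(S k) doubleS; case: #|S k|.
Qed.

Lemma arrangement_inj (g : sgraph) (pi : {ffun g -> 'I_#|g|}) :
  is_arrangement pi -> injective pi.
Proof. by case/andP => /injectiveP. Qed.

Lemma inj_arrangement (g : sgraph) (pi : {ffun g -> 'I_#|g|}) :
  injective pi -> is_arrangement pi.
Proof.
move=> pi_inj; apply/andP; split; first exact/injectiveP.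
by apply/forallP => i; rewrite inj_card_onto ?card_ord.
Qed.

Lemma acyclic_Dmax_le (g : sgraph) : acyclic g -> Dmax g <= max_length_sum #|g|.
Proof.
by move=> acy; apply/bigmax_leqP => pi /arrangement_inj; apply: acyclic_D_le.
Qed.

(** * The bistar and its extremal arrangement *)

Lemma ucycle_two_neighbours (g : sgraph) (c : seq g) (x : g) :
  ucycle (@sedge g) c -> 2 < size c -> x \in c ->
  exists y z, [/\ sedge x y, sedge x z & y != z].
Proof.
move=> /andP[cyc Uc] sz /rot_to[i p rotE].
have: cycle (@sedge g) (x :: p) by rewrite -rotE rot_cycle.
have: uniq (x :: p) by rewrite -rotE rot_uniq.
have: 2 < size (x :: p) by rewrite -rotE size_rot.
case: p {rotE} => [|y [|z p]] //= _ /and3P[_ yN _].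
rewrite rcons_path => /and4P[xy _ _ lastx].
exists y, (last z p); split=> //; first by rewrite sedge_sym.
by apply: contraNneq yN => ->; apply: mem_last.
Qed.

(** A leaf has a single neighbour, so a cycle on three or more vertices could only visit the two
    hubs. *)
Lemma bistar_acyclic (a b : nat) : acyclic (bistar a.+1 b.+1).
Proof.
move=> c ucyc; rewrite leqNgt; apply/negP => sz.
have hubs : {subset c <= [:: inl ord0; inr ord0 : bistar a.+1 b.+1]}.
  move=> x /(ucycle_two_neighbours ucyc sz)[y [z []]]; rewrite !inE.
  case: x => [] [[|i] ?] //; case: y => [] [[|j] ?] //; case: z => [] [[|k] ?] //;
    rewrite /sedge /= /star_rel /= ?andbF ?andbT //= => _ _ /eqP[];
    by congr (_ _); apply: val_inj.
by have := uniq_leq_size (proj2 (andP ucyc)) hubs; rewrite leqNgt sz.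
Qed.

Lemma Dmax_ge (g : sgraph) (f : g -> nat) : injective f ->
  (forall x, f x < #|g|) ->
  \sum_x \sum_y sedge x y * `|f x - f y|%N <= (Dmax g).*2.
Proof.
move=> f_inj f_lt; pose pi : {ffun g -> 'I_#|g|} := [ffun x => Ordinal (f_lt x)].
have pi_inj : injective pi by move=> x y; rewrite !ffunE => -[/f_inj].
apply: (@leq_trans (D pi).*2).
  rewrite double_D; apply: leq_sum => x _; apply: leq_sum => y _.
  by rewrite !ffunE.
by rewrite leq_double; apply: leq_bigmax_cond; apply: inj_arrangement.
Qed.

(** From left to right: left hub, leaves of the right hub in decreasing order, leaves of the left
    hub, right hub. *)
Definition bistar_pos (a b : nat) (x : bistar a.+1 b.+1) : nat :=
  match x with
  | inl i => if i == 0 :> nat then 0 else b + i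
  | inr j => if j == 0 :> nat then a + b + 1 else b.+1 - j
  end.

Lemma bistar_pos_inj (a b : nat) : injective (@bistar_pos a b).
Proof.
move=> [[i ia]|[i ia]] [[j ja]|[j ja]] /=; (do 2 case: ifP => /=) => hi hj hij;
  try (by exfalso; lia); by congr (_ _); apply: val_inj => /=; lia.
Qed.

Lemma bistar_pos_lt (a b : nat) (x : bistar a.+1 b.+1) :
  bistar_pos x < #|bistar a.+1 b.+1|.
Proof.
by rewrite card_sum !card_ord; case: x => [] [i ia] /=; case: ifP; lia.
Qed.

Lemma bistar_Dmax_ge (a b : nat) :
  a + b + 1 + \sum_(i < a) (b.+1 + i) + \sum_(j < b) (a.+1 + j)
    <= Dmax (bistar a.+1 b.+1).
Proof.
rewrite -leq_double.
apply: leq_trans (Dmax_ge (@bistar_pos_inj a b) (@bistar_pos_lt a b)).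
have sumE (F : bistar a.+1 b.+1 -> nat) :
    \sum_x F x = \sum_(i < a.+1) F (inl i) + \sum_(j < b.+1) F (inr j).
  exact: (big_sumType addn xpredT F).
(* [T x] is the total length of the edges at [x]. A leaf edge is counted at its leaf and at its hub,
   the hub edge of length [a + b + 1] at both hubs, which gives the doubled bound. *)
pose T (x : bistar a.+1 b.+1) := \sum_y sedge x y * `|bistar_pos x - bistar_pos y|%N.
have T_ge (x y : bistar a.+1 b.+1) : sedge x y -> `|bistar_pos x - bistar_pos y|%N <= T x.
  by move=> exy; rewrite /T (bigD1 y) // exy mul1n leq_addr.
have Tl (i : 'I_a) : b.+1 + i <= T (inl (lift ord0 i)).
  have := T_ge (inl (lift ord0 i)) (inl ord0) isT.
  by rewrite /= /bump /=; lia.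
have Tr (j : 'I_b) : a.+1 + j <= T (inr (lift ord0 j)).
  have := T_ge (inr (lift ord0 j)) (inr ord0) isT.
  by rewrite /= /bump /=; have := ltn_ord j; lia.
have Tl0 : a + b + 1 + \sum_(i < a) (b.+1 + i) <= T (inl ord0).
  rewrite /T sumE addnC; apply: leq_add.
    rewrite big_ord_recl; apply: leq_trans (leq_addl _ _).
    by apply: leq_sum => i _; rewrite /= /bump /=; lia.
  by rewrite big_ord_recl /= mul1n; lia.
have Tr0 : a + b + 1 + \sum_(j < b) (a.+1 + j) <= T (inr ord0).
  rewrite /T sumE; apply: leq_add; first by rewrite big_ord_recl /= mul1n; lia.
  rewrite big_ord_recl; apply: leq_trans (leq_addl _ _).
  by apply: leq_sum => j _; rewrite /= /bump /=; have := ltn_ord j; lia.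
have sTl : \sum_(i < a) (b.+1 + i) <= \sum_(i < a) T (inl (lift ord0 i)).
  by apply: leq_sum.
have sTr : \sum_(j < b) (a.+1 + j) <= \sum_(j < b) T (inr (lift ord0 j)).
  by apply: leq_sum.
apply: (@leq_trans (\sum_x T x)) => //; rewrite sumE !big_ord_recl.
by apply: leq_trans (leq_add (leq_add Tl0 sTl) (leq_add Tr0 sTr)); lia.
Qed.

Lemma double_sum_interval (a c : nat) :
  (\sum_(i < a) (c + i)).*2 + a = a * (c.*2 + a).
Proof.
elim: a => [|a IHa]; first by rewrite big_ord0.
rewrite big_ord_recr /=; move: IHa; set s := \sum_(i < a) _; nia.
Qed.

Lemma balanced_bistar_Dmax (n : nat) : 2 <= n ->
  Dmax (balanced_bistar n) = max_length_sum n.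
Proof.
move=> n2; rewrite /balanced_bistar.
have [a aE] : exists a, uphalf n = a.+1 by exists (uphalf n).-1; lia.
have [b bE] : exists b, n./2 = b.+1 by exists (n./2).-1; lia.
have nE : n = a.+1 + b.+1 by rewrite -aE -bE; lia.
rewrite aE bE; apply/eqP; rewrite eqn_leq; apply/andP; split.
  have := acyclic_Dmax_le (@bistar_acyclic a b).
  by rewrite card_sum !card_ord -nE.
apply: leq_trans (bistar_Dmax_ge a b).
have := double_sum_interval a b.+1; have := double_sum_interval b a.+1.
(* Here [a] and [b] are the leaf counts, and the two cases are even and odd [n]. *)
have : a = b \/ a = b.+1 by lia.
have -> : max_length_sum n = (a + b + 1) * b.+1 + a ^ 2.
  by rewrite /max_length_sum; congr (_ * _ + _ ^ _); lia.
by rewrite -mulnn => -[] ->; nia.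
Qed.

Local Open Scope ring_scope.

Theorem theorem1 (n : nat) (hn : (2 <= n)%N) :
  (forall t : sgraph, is_tree t -> #|t| = n ->
     (Dmax t <= Dmax (balanced_bistar n))%N) /\
  ((Dmax (balanced_bistar n))%:R =
     1 / 4 * (3 * (n%:R - 1) ^+ 2 + 1 - (n %% 2)%N%:R) :> rat).
Proof.
rewrite balanced_bistar_Dmax //; split=> [t [_ acy] <-|].
  exact: acyclic_Dmax_le.
(* Writing [n - 1 = 2 * m + r] turns the halves into [m + r] and [m], so each parity becomes a
   polynomial identity over the rationals. *)
have [m [r [nE rE]]] : exists m, exists r : bool,
    n = (m.*2 + r.+1)%N /\ (n %% 2)%N = ~~ r.
  by exists n.-1./2, (odd n.-1); rewrite modn2; lia.
have -> : max_length_sum n = ((m.*2 + r) * (m + r) + m ^ 2)%N.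
  by rewrite /max_length_sum; congr (_ * _ + _ ^ _)%N; lia.
by rewrite rE nE -muln2; case: r {nE rE} => /=; field.
Qed.
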